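(* Let $P_1<P_2<\cdots<P_n$ and $V_1<V_2$ be real numbers, and consider the ordering $\sigma$ of $\{P_1,\dots,P_n\}$ in which $P_i$ precedes $P_j$ iff $|V_1-P_i|+|V_2-P_i|<|V_1-P_j|+|V_2-P_j|$. Assume there are no ties, i.e. the values $|V_1-P_i|+|V_2-P_i|$ are pairwise distinct. Then there is a single point $V\in\mathbb{R}$ such that the values $|V-P_i|$ are pairwise distinct and ordering the $P_i$ by $|V-P_i|$ gives exactly $\sigma$. *)

(* Defs.v *)
From mathcomp Require Import all_boot all_order all_algebra.
From mathcomp Require Import reals.

Set Implicit Arguments.
Unset Strict Implicit.
Unset Printing Implicit Defensive.

Import Order.TTheory GRing.Theory Num.Theory.
Local Open Scope ring_scope.

(* The ordering of P_1, ..., P_n (0-indexed by 'I_n) by increasing score, as a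
   precedence relation. It is a strict linear order when [score] is injective;
   tied points are incomparable. *)
Definition order_by (R : realType) (n : nat) (score : 'I_n -> R) : rel 'I_n :=
  fun i j => score i < score j.

(* Main.v *)
(* The sum of distances to [V1] and [V2] is [max (2 |M - x|) (V2 - V1)] with [M]
   the midpoint, a nondecreasing function of [|M - x|]. As there are no ties, it
   orders the points exactly as [|M - x|] does, so [V := M] works. *)
Require Import Defs.
From mathcomp Require Import all_boot all_order all_algebra.
From mathcomp Require Import reals.
From mathcomp Require Import lra.

Import Order.TTheory GRing.Theory Num.Theory.
Local Open Scope ring_scope.

(** For [x] outside [[a, b]] both differences have the same sign, so they add up to twice the
    distance to the midpoint, which is at least [b - a]. Between [a] and [b] the sum is constantly
    [b - a], which dominates the other term. *)
Lemma dist_sum_midpoint (R : realFieldType) (a b x : R) : a <= b ->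
  `|a - x| + `|b - x| = Num.max (2 * `|(a + b) / 2 - x|) (b - a).
Proof.
move=> le_ab; case: (ger0P (a - x)) => ha; case: (ger0P (b - x)) => hb;
  case: (ger0P ((a + b) / 2 - x)) => hm;
  case: leP => hab; lra.
Qed.

(** A monotone [f] can lose strictness only by merging two values, which injectivity of [f \o g]
    excludes on the image of [g]. Injectivity is asked of the composite because [f] will be a max
    with a constant, flat on a half-line. *)
Lemma injective_homo_le_lt {d d' : Order.disp_t} {S : orderType d}
    {S' : porderType d'} {I : Type} (f : S -> S') (g : I -> S) :
  {homo f : x y / (x <= y)%O} -> injective (f \o g) ->
  forall i j, (f (g i) < f (g j))%O = (g i < g j)%O.
Proof.
move=> f_homo fg_inj i j; case: (ltP (g i) (g j)) => [lt_ij | le_ji].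
  rewrite lt_neqAle f_homo ?(ltW lt_ij) // andbT.
  by apply/eqP => /fg_inj eq_ij; rewrite eq_ij ltxx in lt_ij.
exact: le_gtF (f_homo _ _ le_ji).
Qed.

Theorem theorem5p5 (R : realType) (n : nat) (P : 'I_n -> R) (V1 V2 : R)
    (sigma : rel 'I_n)
    (P_incr : forall i j : 'I_n, (i < j)%N -> P i < P j)
    (V1_lt_V2 : V1 < V2)
    (sigmaE : sigma =2 order_by (fun i => `|V1 - P i| + `|V2 - P i|))
    (no_ties : injective (fun i => `|V1 - P i| + `|V2 - P i|)) :
  exists V : R,
    injective (fun i => `|V - P i|) /\
    order_by (fun i => `|V - P i|) =2 sigma.
Proof.
pose f (t : R) := Num.max (2 * t) (V2 - V1).
pose g i := `|(V1 + V2) / 2 - P i|.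
have fgE i : `|V1 - P i| + `|V2 - P i| = f (g i).
  exact: dist_sum_midpoint (ltW V1_lt_V2).
have fg_inj : injective (f \o g).
  by move=> i j eq_ij; apply: no_ties; rewrite /= !fgE.
have f_homo : {homo f : x y / x <= y}.
  by move=> x y le_xy; apply: le_max2 => //; rewrite ler_pM2l.
(* Equal distances to the midpoint would give equal sums, so the absence of ties carries over to
   [g]. *)
exists ((V1 + V2) / 2); split; first exact: inj_compr fg_inj.
move=> i j; rewrite sigmaE /order_by !fgE.
by rewrite (injective_homo_le_lt _ _ f_homo fg_inj).
Qed.
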